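(* Let $E$ be a finite directed graph with a root and without circuits. Then $E$ is (isomorphic to) the proper communication graph of the left Krieger cover of an AFT shift if there is an edge from $u\in E^0$ to $v\in E^0$ whenever $u>v$.
   Context: Directed graphs here have at most one edge between any ordered pair of vertices of $E$. A circuit is a path of length at least $1$ with the same source and range (in particular $E$ has no loops). For vertices, $u\ge v$ means there is a path from $u$ to $v$; $u>v$ means $u\geq v$ and $u\neq v$. A vertex is maximal if it is connected to all other vertices; a root is a unique maximal vertex. Proper communication graph of a directed graph $F$: vertices $u,v\in F^0$ properly communicate if there are paths of length at least $1$ from $u$ to $v$ and from $v$ to $u$. This partitions the vertices lying on circuits into maximal sets, the proper communication sets. The proper communication graph $PC(F)$ has the proper communication sets as vertices, and an edge from one proper communication set to another (different) one iff there is a path in $F$ from a vertex in the first to a vertex in the second. A shift space over a finite alphabet $\mathcal{A}$ is a closed shift-invariant $X\subseteq\mathcal{A}^{\mathbb{Z}}$; it is sofic if it is the set of label sequences of biinfinite paths in a finite labelled graph (a presentation of $X$); it is irreducible if for all words $u,w$ of its language there is $v$ with $uvw$ in its language. $X^-$ and $X^+$ are the sets of left-rays and right-rays of elements of $X$, and $P_\infty(x^+)=\{y^-\in X^-\mid y^-x^+\in X\}$. The left Krieger cover of $X$ is the labelled graph with vertex set $\{P_\infty(x^+)\mid x^+\in X^+\}$ and an edge labelled $a$ from $P$ to $P'$ iff there is $x^+\in X^+$ with $P=P_\infty(ax^+)$, $P'=P_\infty(x^+)$; its proper communication graph is that of the underlying unlabelled graph. A labelled graph is left-resolving if no vertex receives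 two edges with the same label. The left Fischer cover of an irreducible sofic shift is its (unique up to isomorphism) left-resolving presentation with fewest vertices. A labelled graph is right-closing if there is $l\in\mathbb{N}$ such that any two paths of length $l$ with the same source and the same label have the same first edge. An irreducible sofic shift is an AFT shift (of almost finite type) if its left Fischer cover is right-closing. *)

(* Defs.v *)
From HB Require Import structures.
From mathcomp Require Import all_boot all_order all_algebra.
From mathcomp Require Import boolp classical_sets topology.

Set Implicit Arguments.
Unset Strict Implicit.
Unset Printing Implicit Defensive.

Local Open Scope classical_set_scope.

(** * Finite directed graphs with at most one edge between ordered pairs *)

Section FiniteDigraph.
Variables (V : finType) (e : rel V).

Definition circuit (x : V) (p : seq V) : bool :=
  [&& path e x p, last x p == x & (0 < size p)%N].

(* [connect e u v] is u >= v: it includes the paths of length 0 *)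
Definition vertex_gt (u v : V) : bool := connect e u v && (u != v).

Definition maximal_vertex (r : V) : Prop :=
  forall v : V, v != r -> connect e r v.

End FiniteDigraph.

(** * Directed multigraphs and labelled graphs *)

(* Carriers are arbitrary types because the vertices of the left Krieger cover
   are sets of rays; parallel edges are needed for labelled graphs. *)
Record graph := Graph {
  vertex : Type;
  edge : Type;
  src : edge -> vertex;
  tgt : edge -> vertex }.

Record lgraph (A : Type) := LGraph {
  ugraph :> graph;
  lab : edge ugraph -> A }.

Record fin_lgraph (A : Type) := FinLGraph {
  fvertex : finType;
  fedge : finType;
  fsrc : fedge -> fvertex;
  ftgt : fedge -> fvertex;
  flab : fedge -> A }.

Definition lgraph_of_fin (A : Type) (G : fin_lgraph A) : lgraph A :=
  @LGraph A (Graph (@fsrc A G) (@ftgt A G)) (@flab A G).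
Coercion lgraph_of_fin : fin_lgraph >-> lgraph.

Fixpoint gpath (G : graph) (u : vertex G) (p : seq (edge G)) (v : vertex G)
    : Prop :=
  if p is e :: p' then src e = u /\ gpath (tgt e) p' v else u = v.

(** * Proper communication graph *)

Section ProperCommunication.
Variable F : graph.

Definition properly_communicate (u v : vertex F) : Prop :=
  (exists2 p, gpath u p v & (0 < size p)%N) /\
  (exists2 q, gpath v q u & (0 < size q)%N).

(* the classes of the vertices lying on a circuit, i.e. communicating properly
   with themselves *)
Definition pc_set (C : set (vertex F)) : Prop :=
  exists2 u, properly_communicate u u & C = [set v | properly_communicate u v].

Definition pc_vertex : Type := {C : set (vertex F) | pc_set C}.

Definition pc_edge (C D : pc_vertex) : Prop :=
  C <> D /\ exists u v p, [/\ sval C u, sval D v & gpath u p v].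

End ProperCommunication.

Definition isomorphic_to_PC (V : finType) (e : rel V) (F : graph) : Prop :=
  exists f : V -> pc_vertex F,
    bijective f /\ forall u v, e u v <-> pc_edge (f u) (f v).

(** * Shift spaces *)

Section Shifts.
Variable A : finType.

Definition full_shift : Type :=
  prod_topology (fun _ : int => discrete_topology A).

Definition shift_map (x : int -> A) : int -> A := fun i => x (i + 1)%R.

Definition shift_space (X : set (int -> A)) : Prop :=
  closed (X : set full_shift) /\ shift_map @` X = X.

Definition biinfinite_path (G : graph) (pi : int -> edge G) : Prop :=
  forall i : int, tgt (pi i) = src (pi (i + 1)%R).

Definition presentation (X : set (int -> A)) (G : fin_lgraph A) : Prop :=
  X = [set x | exists2 pi : int -> edge G,
                 biinfinite_path pi & x = fun i => lab (pi i)].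

Definition sofic (X : set (int -> A)) : Prop :=
  shift_space X /\ exists G : fin_lgraph A, presentation X G.

Definition language (X : set (int -> A)) : set (seq A) :=
  [set w | exists2 x, X x &
     exists i : int, w = [seq x (i + k%:Z)%R | k <- iota 0 (size w)]].

Definition irreducible_shift (X : set (int -> A)) : Prop :=
  forall u w, language X u -> language X w ->
    exists v, language X (u ++ v ++ w).

(** ** Rays and the left Krieger cover *)

(* A right-ray x_0 x_1 x_2 ... is n |-> x_n; a left-ray ... y_{-2} y_{-1} is
   n |-> y_{-(n+1)}, matching [Negz n = - (n + 1)]. *)
Definition right_rays (X : set (int -> A)) : set (nat -> A) :=
  [set r | exists2 x, X x & r = fun n => x (Posz n)].

Definition left_rays (X : set (int -> A)) : set (nat -> A) :=
  [set l | exists2 x, X x & l = fun n => x (Negz n)].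

Definition ray_cat (y x : nat -> A) : int -> A :=
  fun i => match i with Posz n => x n | Negz n => y n end.

Definition ray_cons (a : A) (x : nat -> A) : nat -> A :=
  fun n => if n is m.+1 then x m else a.

Definition P_inf (X : set (int -> A)) (x : nat -> A) : set (nat -> A) :=
  [set y | left_rays X y /\ X (ray_cat y x)].

Definition krieger_vertex (X : set (int -> A)) : Type :=
  {P : set (nat -> A) | exists2 x, right_rays X x & P = P_inf X x}.

(* When [a x] is not a right-ray of X, [P_inf X (a x)] is empty, hence not a
   vertex, so [a x] is a right-ray of X in every edge below. *)
Definition krieger_edge (X : set (int -> A)) : Type :=
  {t : krieger_vertex X * A * krieger_vertex X |
    exists2 x, right_rays X x &
      sval t.1.1 = P_inf X (ray_cons t.1.2 x) /\ sval t.2 = P_inf X x}.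

Definition left_krieger_cover (X : set (int -> A)) : lgraph A :=
  @LGraph A
    (@Graph (krieger_vertex X) (krieger_edge X)
       (fun t => (sval t).1.1) (fun t => (sval t).2))
    (fun t => (sval t).1.2).

(** ** Left Fischer cover and AFT shifts *)

Definition left_resolving (G : lgraph A) : Prop :=
  forall e f : edge G, tgt e = tgt f -> lab e = lab f -> e = f.

Definition left_fischer_cover (X : set (int -> A)) (G : fin_lgraph A) : Prop :=
  [/\ presentation X G, left_resolving G &
      forall H : fin_lgraph A, presentation X H -> left_resolving H ->
        (#|fvertex G| <= #|fvertex H|)%N].

(* [0 < l]: paths of length 0 have no first edge, so l = 0 would be vacuous *)
Definition right_closing (G : lgraph A) : Prop :=
  exists2 l : nat, (0 < l)%N &
    forall (u v w : vertex G) (p q : seq (edge G)),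
      gpath u p v -> gpath u q w -> size p = l -> size q = l ->
      [seq lab e | e <- p] = [seq lab e | e <- q] -> ohead p = ohead q.

(* The left Fischer cover is unique up to isomorphism, so "its" cover is
   rendered by an existential. *)
Definition AFT_shift (X : set (int -> A)) : Prop :=
  [/\ sofic X, irreducible_shift X &
      exists2 G : fin_lgraph A, left_fischer_cover X G & right_closing G].

End Shifts.

(* Main.v *)
Require Import Defs.
From HB Require Import structures.
From mathcomp Require Import all_boot all_order all_algebra.
From mathcomp Require Import boolp classical_sets topology.
From mathcomp Require Import cardinality zify.

(* The hypotheses say that [E] is a finite strict partial order with a greatest
   element r.  Consider the labelled graph with a vertex * and two copies of
   each v <> r; there are edges from * to *, and from * to each copy and back,
   with pairwise distinct labels, and for u >= v an edge from each copy of u to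
   the corresponding copy of v, these two edges sharing one label.  This graph
   is left-resolving, right-closing and strongly connected.  A right-ray
   visiting * can be read from a single vertex, while one avoiding * can be read
   exactly from the two copies of some v.  So the vertices of the left Krieger
   cover are the predecessor sets of single vertices, which communicate through
   * and form the class of r, and for each v <> r the predecessor set P_v of its
   pair of copies.  Extending a ray to the left inside the copies leads from P_v
   to P_u exactly when u >= v, and extending it through * leads to the class of
   r; edges of the cover point the other way, so P_u reaches P_v iff u >= v. *)

Set Implicit Arguments.
Unset Strict Implicit.
Unset Printing Implicit Defensive.

Import GRing.Theory.

Local Open Scope classical_set_scope.

(** * Shifts presented by finite labelled graphs *)

Lemma compact_full_shift (A : finType) : compact [set: full_shift A].
Proof.
have := @tychonoff int (fun _ => discrete_topology A) (fun _ => setT).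
rewrite (_ : [set _ | _] = setT); last by apply/seteqP; split.
apply => _; apply: finite_compact; exact: (@finite_finset A).
Qed.

Lemma hausdorff_full_shift (A : finType) : hausdorff_space (full_shift A).
Proof. by apply: hausdorff_product => _; apply: discrete_hausdorff. Qed.

Lemma coordinate_continuous (A : finType) (i : int) :
  continuous (fun x : full_shift A => x i : discrete_topology A).
Proof. exact: (@proj_continuous int (fun _ => discrete_topology A) i). Qed.

Lemma open_coordinate (A : finType) (i : int) (P : set A) :
  open [set x : full_shift A | P (x i)].
Proof.
have /continuousP/(_ P) := @coordinate_continuous A i.
by apply; exact: discrete_open.
Qed.

(** The product topology is generated by the coordinates, and letters are discrete, so preimages of
    single-letter cylinders suffice. *)
Lemma continuous_full_shift (T : topologicalType) (A : finType)
    (f : T -> full_shift A) :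
  (forall i (a : A), open [set t | f t i = a]) -> continuous f.
Proof.
move=> fO t; apply/cvg_sup => i B [C [[D oD <-] Dft] CB].
apply: (filterS CB); apply: (@filterS _ _ _ [set s | f s i = f t i]).
  by move=> s /= fsi; rewrite /preimage /= fsi.
by apply: open_nbhs_nbhs; split => //; apply: fO.
Qed.

Section LabelShift.
Variables (A : finType) (G : fin_lgraph A).

Definition label_shift : set (int -> A) :=
  [set x | exists2 pi : int -> edge G,
             biinfinite_path pi & x = fun i => lab (pi i)].

(** A failure to be a path shows at two adjacent coordinates, and fixing these two gives an open
    neighbourhood of failures. *)
Lemma closed_biinfinite_path :
  closed ([set pi | @biinfinite_path G pi] : set (full_shift (fedge G))).
Proof.
rewrite -openC openE => pi /= /existsNP[i npi].
apply: (@filterS _ _ _ ([set p : full_shift (fedge G) | p i = pi i] `&`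
  [set p : full_shift (fedge G) | p (i + 1)%R = pi (i + 1)%R])).
  by move=> p [/= pi1 pi2] /(_ i); rewrite pi1 pi2; exact: npi.
apply: filterI; apply: open_nbhs_nbhs; split => //.
  exact: (@open_coordinate _ _ [set pi i]).
exact: (@open_coordinate _ _ [set pi (i + 1)%R]).
Qed.

Lemma closed_label_shift : closed (label_shift : set (full_shift A)).
Proof.
pose f (pi : full_shift (fedge G)) : full_shift A := fun i => flab (pi i).
have -> : label_shift = f @` [set pi | @biinfinite_path G pi].
  apply/seteqP; split=> x [pi Hpi]; last by move=> <-; exists pi.
  by move=> ->; exists pi.
(* The labelling is a continuous map from the compact space of biinfinite paths to a Hausdorff
   space, so its image is closed. *)
apply: compact_closed; first exact: hausdorff_full_shift.
apply: (@continuous_compact (full_shift (fedge G)) (full_shift A) f); last first.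
  by apply: subclosed_compact closed_biinfinite_path (@compact_full_shift _) _.
apply: continuous_subspaceT; apply: continuous_full_shift => i a.
exact: (@open_coordinate _ i [set e | flab e = a]).
Qed.

Lemma label_shift_shift (x : int -> A) (k : int) :
  label_shift x -> label_shift (fun i => x (i + k)%R).
Proof.
case=> pi Hpi ->; exists (fun i => pi (i + k)%R) => // i.
by rewrite addrAC; apply: Hpi.
Qed.

Lemma shift_space_label_shift : shift_space label_shift.
Proof.
split; first exact: closed_label_shift.
apply/seteqP; split=> [_ [x Xx <-]|x Xx]; first exact: label_shift_shift.
exists (fun i => x (i + -1)%R); first exact: label_shift_shift.
by apply/funext => i; rewrite /shift_map -addrA subrr addr0.
Qed.

End LabelShift.

(** * Rays, predecessor sets and the language of a presented shift *)

Section Rays.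
Variables (A : finType) (G : fin_lgraph A).

Definition ray_from (v : vertex G) : set (nat -> A) :=
  [set x | exists rho : nat -> edge G,
    [/\ src (rho 0) = v, forall n, tgt (rho n) = src (rho n.+1) &
        x = fun n => lab (rho n)]].

Definition ray_to (v : vertex G) : set (nat -> A) :=
  [set y | exists rho : nat -> edge G,
    [/\ tgt (rho 0) = v, forall n, tgt (rho n.+1) = src (rho n) &
        y = fun n => lab (rho n)]].

Lemma ray_from_cons (v : vertex G) a x : ray_from v (ray_cons a x) <->
  exists e : edge G, [/\ src e = v, lab e = a & ray_from (tgt e) x].
Proof.
split=> [[rho [rho0 rhoS labE]]|[e [<- <- [rho [rho0 rhoS ->]]]]].
  exists (rho 0); split=> //; first by rewrite -[RHS]/(ray_cons a x 0) labE.
  exists (rho \o succn); split=> //= [|n|]; [exact/esym/rhoS|exact: rhoS|].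
  by apply/funext => n; rewrite -[LHS]/(ray_cons a x n.+1) labE.
exists (fun n => if n is m.+1 then rho m else e); split=> //.
  by case=> [|n] /=; [exact: esym rho0|exact: rhoS].
by apply/funext => -[].
Qed.

Lemma ray_to_cons (v : vertex G) a y : ray_to v (ray_cons a y) <->
  exists e : edge G, [/\ tgt e = v, lab e = a & ray_to (src e) y].
Proof.
split=> [[rho [rho0 rhoS labE]]|[e [<- <- [rho [rho0 rhoS ->]]]]].
  exists (rho 0); split=> //; first by rewrite -[RHS]/(ray_cons a y 0) labE.
  exists (rho \o succn); split=> //= [|n|]; [exact: rhoS|exact: rhoS|].
  by apply/funext => n; rewrite -[LHS]/(ray_cons a y n.+1) labE.
exists (fun n => if n is m.+1 then rho m else e); split=> //.
  by case=> [|n] /=; [exact: rho0|exact: rhoS].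
by apply/funext => -[].
Qed.

(** A biinfinite path is cut at the source of its edge at position 0, and conversely two one-sided
    paths meeting at a vertex are glued there. *)
Lemma label_shift_ray_cat y x : label_shift G (ray_cat y x) <->
  exists v, ray_to v y /\ ray_from v x.
Proof.
split=> [[pi Hpi labE]|[v [[l [l0 lS ->]] [rho [rho0 rhoS ->]]]]].
  exists (src (pi 0%R)); split.
    exists (fun n => pi (Negz n)); split.
    - by rewrite Hpi.
    - by move=> n; rewrite Hpi; congr (src (pi _)); lia.
    - by apply/funext => n; rewrite -[LHS]/(ray_cat y x (Negz n)) labE.
  exists (fun n => pi (Posz n)); split=> //.
  - by move=> n; rewrite Hpi; congr (src (pi _)); lia.
  - by apply/funext => n; rewrite -[LHS]/(ray_cat y x (Posz n)) labE.
(* Only the junction of positions -1 and 0 uses the common vertex [v]. *)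
exists (@ray_cat (fedge G) l rho).
  case=> [n|[|n]].
  - by rewrite (_ : (Posz n + 1)%R = Posz n.+1); [exact: rhoS|lia].
  - by rewrite (_ : (Negz 0 + 1)%R = Posz 0); [rewrite [LHS]l0|].
  - by rewrite (_ : (Negz n.+1 + 1)%R = Negz n); [exact: lS|lia].
by apply/funext => -[].
Qed.

Lemma right_rays_label_shift x :
  (forall v : vertex G, exists y, ray_to v y) ->
  right_rays (label_shift G) x <-> exists v : vertex G, ray_from v x.
Proof.
move=> toG; split=> [[z Xz ->]|[v xv]].
  have : label_shift G (ray_cat (fun n => z (Negz n)) (fun n => z (Posz n))).
    by rewrite (_ : ray_cat _ _ = z) //; apply/funext => -[].
  by case/label_shift_ray_cat => v [_ ?]; exists v.
have [y yv] := toG v; exists (ray_cat y x) => //.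
by apply/label_shift_ray_cat; exists v.
Qed.

Lemma P_inf_label_shift x :
  P_inf (label_shift G) x = [set y | exists2 v, ray_from v x & ray_to v y].
Proof.
apply/seteqP; split=> [y [_ /label_shift_ray_cat[v []]]|y [v xv yv]].
  by exists v.
have Xyx : label_shift G (ray_cat y x) by apply/label_shift_ray_cat; exists v.
by split=> //; exists (ray_cat y x).
Qed.

Definition essential := forall v : vertex G,
  (exists y, ray_to v y) /\ (exists x, ray_from v x).

Lemma gpath_cat (F : graph) (u v w : vertex F) p q :
  gpath u p v -> gpath v q w -> gpath u (p ++ q) w.
Proof.
elim: p u => [u /= -> //|e p IHp u /= [<- epv] vqw]; split=> //.
exact: IHp.
Qed.

Lemma gpath_iota (pi : int -> edge G) (i : int) (n : nat) :
  biinfinite_path pi ->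
  gpath (src (pi i)) [seq pi (i + k%:Z)%R | k <- iota 0 n] (src (pi (i + n%:Z)%R)).
Proof.
move=> Hpi; elim: n i => [i|n IHn i]; first by rewrite addr0.
have := IHn (i + 1)%R; rewrite -Hpi -addrA -intS /= addr0.
rewrite (iotaDl 1 0) -map_comp => pathn; split=> //.
rewrite (eq_map (g := fun k => pi ((i + 1) + k%:Z)%R)) // => k /=.
by congr pi; lia.
Qed.

(** In an essential graph every finite path extends to a biinfinite one, so its label is a word of
    the shift. *)
Lemma languageP w : essential -> language (label_shift G) w <->
  exists u p v, gpath (G := G) u p v /\ w = [seq lab e | e <- p].
Proof.
move=> essG; split=> [[_ [pi Hpi ->] [i ->]]|[u [p [v [upv ->]]]]].
  exists (src (pi i)), [seq pi (i + k%:Z)%R | k <- iota 0 (size w)].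
  exists (src (pi (i + (size w)%:Z)%R)); split; first exact: gpath_iota.
  by rewrite -map_comp.
have [_ [x vx]] := essG v; have [[y uy] _] := essG u.
pose z := foldr (@ray_cons A) x [seq lab e | e <- p].
exists (ray_cat y z).
  apply/label_shift_ray_cat; exists u; split=> //; rewrite /z.
  elim: p u upv {uy z} => [u /= ->//|e p IHp u /= [<- epv]].
  by apply/ray_from_cons; exists e; split=> //; exact: IHp.
exists 0%R; rewrite size_map /z.
elim: p {upv z} => [//|e p IHp] /=; congr cons.
rewrite [LHS]IHp (iotaDl 1 0) -[RHS]map_comp.
by apply: eq_map => k.
Qed.

Lemma irreducible_label_shift : essential ->
  (forall u v : vertex G, exists p, gpath u p v) ->
  irreducible_shift (label_shift G).
Proof.
move=> essG conn w1 w2 /(languageP _ essG)[u1 [p1 [v1 [path1 ->]]]].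
move=> /(languageP _ essG)[u2 [p2 [v2 [path2 ->]]]].
have [q pathq] := conn v1 u2; exists [seq lab e | e <- q].
apply/(languageP _ essG); exists u1, (p1 ++ q ++ p2), v2; split.
  exact: gpath_cat path1 (gpath_cat pathq path2).
by rewrite !map_cat.
Qed.

End Rays.

(* The pairs (y v, x v) form a fooling set: in any presentation of X, paths
   labelled y v x v through a common vertex at time 0 could be exchanged. *)
Lemma fooling_set_card (A T : finType) (X : set (int -> A)) (H : fin_lgraph A)
    (y x : T -> nat -> A) :
  presentation X H ->
  (forall v, X (ray_cat (y v) (x v))) ->
  (forall u v, X (ray_cat (y u) (x v)) -> u = v) ->
  (#|T| <= #|fvertex H|)%N.
Proof.
move=> ->; rewrite -/(label_shift H) => Xyx fool.
have /choice[h Hh] : forall v, exists q : vertex H,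
    ray_to q (y v) /\ ray_from q (x v).
  by move=> v; apply/label_shift_ray_cat.
apply: (@leq_card _ _ h) => u v huv; apply: fool.
apply/label_shift_ray_cat; exists (h u); split; first exact: (Hh u).1.
by rewrite huv; exact: (Hh v).2.
Qed.

(** * Proper communication graphs *)

(** Since [e] is a strict order, paths both ways force equal ranks. The proper communication sets
    are therefore the fibres of [rank]. *)
Lemma isomorphic_to_PC_of_rank (V : finType) (e : rel V) (F : graph)
    (rank : vertex F -> V) :
  irreflexive e -> transitive e -> (forall k, exists u, rank u = k) ->
  (forall u v, (exists2 p, gpath u p v & (0 < size p)%N) <->
     rank u = rank v \/ e (rank u) (rank v)) ->
  isomorphic_to_PC e F.
Proof.
move=> irr tr rank_surj pathP.
have pcP u v : properly_communicate u v <-> rank u = rank v.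
  rewrite /properly_communicate !pathP; split=> [[[//|uv] [//|vu]]|->].
    by have := irr (rank u); rewrite (tr _ _ _ uv vu).
  by split; left.
have pcC k : pc_set [set u | rank u = k].
  have [u <-] := rank_surj k; exists u; first exact/pcP.
  by apply/seteqP; split=> v /= => [/esym/pcP|/pcP].
pose f k : pc_vertex F := exist _ _ (pcC k).
have f_inj : injective f.
  move=> k k' [fkk']; have [u uk] := rank_surj k.
  have : [set u | rank u = k] u by [].
  by rewrite fkk' /= uk.
have f_surj C : exists k, f k = C.
  case: C => C HC; have [u uu CE] := HC; exists (rank u); apply: eq_exist.
  by rewrite CE; apply/seteqP; split=> v /= => [/esym/pcP|/pcP].
have [g fK] := choice f_surj.
exists f; split; first by exists g => // k; apply: f_inj; rewrite fK.
move=> k k'; split=> [ekk'|[nkk' [u [v [p [/= uk vk uv]]]]]].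
  split=> [/f_inj kk'|]; first by have := irr k; rewrite {2}kk' ekk'.
  have [u uk] := rank_surj k; have [v vk] := rank_surj k'.
  have [p uv _] : exists2 p, gpath u p v & (0 < size p)%N.
    by apply/pathP; right; rewrite uk vk.
  by exists u, v, p.
(* [pc_edge] also admits the empty path, which would make the two classes equal. *)
case: p uv => [/= uv|a p uv].
  by case: nkk'; congr f; rewrite -uk -vk uv.
have /pathP[] : exists2 p, gpath u p v & (0 < size p)%N by exists (a :: p).
  by rewrite uk vk => kk'; case: nkk'; rewrite kk'.
by rewrite uk vk.
Qed.

(** * The graph with doubled vertices *)

Section DoubledCover.
Variables (W : finType) (lt : rel W).
Hypothesis lt_trans : transitive lt.

Definition state : finType := option (W * bool).

(* [W] is the poset without its greatest element, [None] is the vertex *, and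
   [Some (v, true)], [Some (v, false)] are the copies of [v]. *)
Definition step (p q : state) : bool :=
  match p, q with
  | Some (u, s), Some (v, t) => (s == t) && ((u == v) || lt u v)
  | _, _ => true
  end.

(* Among the copies a label forgets the boolean, so that a ray avoiding [None]
   starts at both copies of its first vertex; all other edges have a label of
   their own. *)
Definition step_label (p q : state) : state * state :=
  match p, q with
  | Some (u, s), Some (v, t) => (Some (u, true), Some (v, true))
  | _, _ => (p, q)
  end.

Definition doubled_cover : fin_lgraph (state * state)%type :=
  @FinLGraph _ state {pq : state * state | step pq.1 pq.2}
    (fun e => (val e).1) (fun e => (val e).2)
    (fun e => step_label (val e).1 (val e).2).

Local Notation letter := (state * state)%type.
Local Notation G := doubled_cover.
Local Notation X := (label_shift G).

(** Between copies the label hides the boolean, but a step preserves it, so the known endpoint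
    restores it. *)
Lemma step_label_left p p' q : step p q -> step p' q ->
  step_label p q = step_label p' q -> p = p'.
Proof.
case: p p' q => [[u s]|] [[u' s']|] [[v t]|] //=; try by move=> _ _ []; congruence.
by move=> /andP[/eqP-> _] /andP[/eqP-> _] [->].
Qed.

Lemma step_label_right p q q' : step p q -> step p q' ->
  step_label p q = step_label p q' -> q = q'.
Proof.
case: p q q' => [[u s]|] [[v t]|] [[v' t']|] //=; try by move=> _ _ []; congruence.
by move=> /andP[/eqP<- _] /andP[/eqP<- _] [->].
Qed.

Lemma step_label_None p q p' q' : step_label p q = step_label p' q' ->
  p = None \/ q = None -> (p, q) = (p', q').
Proof.
by case: p p' q q' => [[u s]|] [[u' s']|] [[v t]|] [[v' t']|] //= H [].
Qed.

Lemma step_edge p q : step p q ->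
  exists e : edge G, [/\ src e = p, tgt e = q & lab e = step_label p q].
Proof. by move=> pq; exists (exist _ (p, q) pq). Qed.

Lemma left_resolving_doubled_cover : left_resolving G.
Proof.
case=> [[p q] /= pq] [[p' q'] /= pq'] /= qq' lab_eq.
apply: val_inj => /=; move: pq' lab_eq; rewrite -qq' => pq' lab_eq.
by rewrite (step_label_left pq pq' lab_eq).
Qed.

Lemma right_closing_doubled_cover : right_closing G.
Proof.
(* Length 1 suffices: by [step_label_right], source and label already determine an edge. *)
exists 1 => // u v w [|e [|? ?]] // [|f [|? ?]] //= [ue _] [uf _] _ _ [lab_eq].
congr Some; apply: val_inj; case: e f ue uf lab_eq => [[p q] /= pq] [[p' q'] /=].
by move=> pq' <- p'p; move: pq'; rewrite p'p => pq' /(step_label_right pq pq') ->.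
Qed.

(** There are no parallel edges, so a path is its sequence of states. *)
Lemma ray_fromP q x : ray_from (G := G) q x <-> exists sigma : nat -> state,
  [/\ sigma 0 = q, forall n, step (sigma n) (sigma n.+1) &
      x = fun n => step_label (sigma n) (sigma n.+1)].
Proof.
split=> [[rho [rho0 rhoS ->]]|[sigma [sigma0 sigmaS ->]]].
  exists (fun n => src (rho n)); split=> // [n|].
    by rewrite -rhoS; exact: (valP (rho n)).
  by apply/funext => n; rewrite -rhoS.
by exists (fun n => exist _ (sigma n, sigma n.+1) (sigmaS n)).
Qed.

Lemma ray_from_step p a x : ray_from (G := G) p (ray_cons a x) <->
  exists q, [/\ step p q, a = step_label p q & ray_from (G := G) q x].
Proof.
rewrite ray_from_cons; split=> [[[[p' q] pq] /= [<- <- qx]]|[q [pq -> qx]]].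
  by exists q.
by exists (exist _ (p, q) pq).
Qed.

Lemma ray_to_step q a y : ray_to (G := G) q (ray_cons a y) <->
  exists p, [/\ step p q, a = step_label p q & ray_to (G := G) p y].
Proof.
rewrite ray_to_cons; split=> [[[[p q'] pq] /= [<- <- py]]|[p [pq -> py]]].
  by exists p.
by exists (exist _ (p, q) pq).
Qed.

(** * Rays that test for given states *)

Definition star_ray : nat -> letter := fun=> (None, None).
(** [out_ray q] can be read from [q] only, and [in_ray q] can be read into [q] only. Index 0 of a
    left-ray is its last letter, so [ray_cons] appends on the right in [in_ray]. *)
Definition out_ray (q : state) : nat -> letter := ray_cons (q, None) star_ray.
Definition in_ray (q : state) : nat -> letter := ray_cons (None, q) star_ray.
Definition loop_ray (v : W) : nat -> letter :=
  fun=> (Some (v, true), Some (v, true)).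

Lemma ray_from_star p : ray_from (G := G) p star_ray <-> p = None.
Proof.
rewrite ray_fromP; split=> [[sigma [<- _ /(congr1 (@^~ 0))/=]]|->].
  by rewrite /star_ray; case: (sigma 0) (sigma 1) => [[u s]|] [[v t]|].
by exists (fun=> None).
Qed.

Lemma ray_to_star : ray_to (G := G) None star_ray.
Proof. by exists (fun=> exist _ (None, None) isT). Qed.

Lemma ray_from_out p q : ray_from (G := G) p (out_ray q) <-> p = q.
Proof.
rewrite ray_from_step; split=> [[p' [_ + /ray_from_star p'N]]|->].
  by rewrite p'N; case: p q => [[u s]|] [[v t]|] //= []; congruence.
by exists None; split; [case: q => [[]|]|case: q => [[]|]|apply/ray_from_star].
Qed.

Lemma ray_to_in p q : ray_to (G := G) p (in_ray q) <-> p = q.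
Proof.
rewrite ray_to_step; split=> [[p' [_ + _]]|->].
  by case: p p' q => [[u s]|] [[u' s']|] [[v t]|] //= []; congruence.
by exists None; split=> //; exact: ray_to_star.
Qed.

Lemma ray_from_loop p v :
  ray_from (G := G) p (loop_ray v) <-> exists s, p = Some (v, s).
Proof.
rewrite ray_fromP; split=> [[sigma [<- _ /(congr1 (@^~ 0))/=]]|[s ->]].
  rewrite /loop_ray; case: (sigma 0) (sigma 1) => [[u s]|] [[u' t]|] // [-> _].
  by exists s.
exists (fun=> Some (v, s)); split=> // n.
by rewrite /step !eqxx.
Qed.

Lemma essential_doubled_cover : essential G.
Proof.
move=> q; split; first by exists (in_ray q); apply/ray_to_in.
by exists (out_ray q); apply/ray_from_out.
Qed.

(** For minimality, [in_ray p] followed by [out_ray q] lies in the shift only if [p = q], so these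
    rays form a fooling set indexed by the states. *)
Lemma left_fischer_doubled_cover : left_fischer_cover X G.
Proof.
split=> [//||H presH _]; first exact: left_resolving_doubled_cover.
apply: (@fooling_set_card _ state X H in_ray out_ray presH) => [q|p q].
  apply/label_shift_ray_cat; exists q.
  by split; [apply/ray_to_in|apply/ray_from_out].
by case/label_shift_ray_cat => q' [/ray_to_in <- /ray_from_out].
Qed.

Lemma AFT_doubled_cover : AFT_shift X.
Proof.
split.
- by split; [exact: shift_space_label_shift|exists G].
- apply: irreducible_label_shift; first exact: essential_doubled_cover.
  (* Any two states are joined by a path of length 2 through [None]. *)
  move=> p q; have [e [ep eN _]] := @step_edge p None (ltac:(by case: p => [[]|])).
  have [f [fN fq _]] := @step_edge None q isT.
  by exists [:: e; f]; split; [|rewrite eN].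
- exists G; first exact: left_fischer_doubled_cover.
  exact: right_closing_doubled_cover.
Qed.

Lemma right_rays_doubled_cover x :
  right_rays X x <-> exists q, ray_from (G := G) q x.
Proof. by apply: right_rays_label_shift => q; exists (in_ray q); apply/ray_to_in. Qed.

(** * Predecessor sets and their ranks *)

Definition rays_into (S : set state) : set (nat -> letter) :=
  [set y | exists2 q, S q & ray_to (G := G) q y].

Lemma rays_into_in_ray S q : rays_into S (in_ray q) <-> S q.
Proof.
split=> [[p Sp /ray_to_in <-]//|Sq].
by exists q => //; apply/ray_to_in.
Qed.

Lemma P_inf_doubled_cover x :
  P_inf X x = rays_into [set q | ray_from (G := G) q x].
Proof. exact: P_inf_label_shift. Qed.

Definition doubled (v : W) : set state := [set q | exists s, q = Some (v, s)].

(** The rank names the communication class: [None] stands for the class of the root and collects all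
    singletons, including those of the copies. *)
Definition has_rank (P : set (nat -> letter)) (k : option W) : Prop :=
  if k is Some v then P = rays_into (doubled v)
  else exists q, P = rays_into [set q].

(** The rays [in_ray q] recover a set of states from its predecessor set, and a pair of copies is
    not a singleton. *)
Lemma has_rank_inj P k k' : has_rank P k -> has_rank P k' -> k = k'.
Proof.
have two v q : rays_into (doubled v) <> rays_into [set q].
  move=> E; have dq s : Some (v, s) = q.
    by apply/(rays_into_in_ray [set q]); rewrite -E; apply/rays_into_in_ray; exists s.
  by have := dq true; rewrite -(dq false).
case: k k' => [v|] [v'|] //=.
- move=> -> E; suff [s [->]] : doubled v' (Some (v, true)) by [].
  by apply/rays_into_in_ray; rewrite -E; apply/rays_into_in_ray; exists true.
- by move=> -> [q] /two.
- by move=> [q ->] /esym/two.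
Qed.

Lemma has_rank_P_inf x q : ray_from (G := G) q x ->
  exists k, has_rank (P_inf X x) k.
Proof.
rewrite ray_fromP => -[sigma [sigma0 sigmaS xE]].
have [[n sigmanN]|sigmaN] := pselect (exists n, sigma n = None).
  exists None, q; rewrite P_inf_doubled_cover; congr rays_into.
  apply/seteqP; split=> q' /=; last first.
    by move=> ->; apply/ray_fromP; exists sigma.
  case/ray_fromP => tau [<- tauS]; rewrite {}xE => labE; rewrite -{}sigma0.
  (* The visit to [None] determines the n-th vertex, and left resolution
     determines all the earlier ones. *)
  have : tau n = sigma n.
    have /(congr1 (@^~ n)) := labE.
    by move/step_label_None => /(_ (or_introl sigmanN)) [-> _].
  elim: n {sigmanN} => // n IHn E; apply: IHn.
  have /(congr1 (@^~ n))/= := labE; rewrite -E => /esym.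
  by apply: step_label_left; [exact: tauS|rewrite E; exact: sigmaS].
(* The ray never visits [None], so it can also be read on the other copies. *)
pose flip (p : state) := omap (fun us : W * bool => (us.1, ~~ us.2)) p.
have flipS n : step (flip (sigma n)) (flip (sigma n.+1)).
  by have := sigmaS n; case: (sigma n) (sigma n.+1) => [[u []]|] [[v []]|].
have flip_lab n : step_label (flip (sigma n)) (flip (sigma n.+1)) =
                  step_label (sigma n) (sigma n.+1).
  have [n0 n1] : sigma n <> None /\ sigma n.+1 <> None.
    by split=> E; apply: sigmaN; [exists n|exists n.+1].
  by case: (sigma n) (sigma n.+1) n0 n1 => [[u s]|] [[v t]|].
case: q sigma0 => [[v s]|] sigma0; last by case: sigmaN; exists 0.
exists (Some v); rewrite /has_rank P_inf_doubled_cover; congr rays_into.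
apply/seteqP; split=> q' /=.
  (* The first label comes from an edge between copies, so it fixes [v] and leaves only the boolean
     free. *)
  case/ray_fromP => tau [<- _]; rewrite xE => /(congr1 (@^~ 0)) /=.
  rewrite sigma0; case E : (sigma 1) => [[v1 s1]|].
    by case: (tau 0) (tau 1) => [[u t]|] [[u' t']|] //= [->] _; exists t.
  by case: sigmaN; exists 1.
case=> t ->; apply/ray_fromP; have [->|] := eqVneq t s.
  by exists sigma.
move=> ts; exists (flip \o sigma); split=> //=.
  by rewrite sigma0 /=; move: ts; case: t s {sigma0} => [] [].
by rewrite xE; apply/funext => n; rewrite flip_lab.
Qed.

(** This adds an extremal element [None] to [lt]. In the application [lt u v] is an edge from u to
    v, so [rank_lt] goes downwards from the root. *)
Definition rank_lt (k k' : option W) : bool :=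
  match k, k' with
  | Some u, Some v => lt u v
  | None, Some _ => true
  | _, None => false
  end.

Lemma rank_lt_trans : transitive rank_lt.
Proof. by move=> [v|] [u|] [w|] //=; exact: lt_trans. Qed.

(** * Edges and paths of the left Krieger cover *)

Lemma krieger_vertex_P_inf x : right_rays X x ->
  exists P : krieger_vertex X, sval P = P_inf X x.
Proof.
move=> Xx.
have Px : exists2 z, right_rays X z & P_inf X x = P_inf X z by exists x.
by exists (exist (fun P => exists2 z, right_rays X z & P = P_inf X z) _ Px).
Qed.

Definition krieger_step (P P' : krieger_vertex X) : Prop :=
  exists a x, [/\ right_rays X x, sval P = P_inf X (ray_cons a x) &
    sval P' = P_inf X x].

Lemma krieger_stepP P P' : krieger_step P P' <->
  exists e : edge (left_krieger_cover X), src e = P /\ tgt e = P'.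
Proof.
split=> [[a [x [Xx PE P'E]]]|[[[[Q a] Q'] [x Xx [/= QE Q'E]]] /= [<- <-]]].
  have ex : exists2 x, right_rays X x &
      sval (P, a, P').1.1 = P_inf X (ray_cons (P, a, P').1.2 x) /\
      sval (P, a, P').2 = P_inf X x by exists x.
  by exists (exist _ (P, a, P') ex).
by exists a, x.
Qed.

Lemma exists_has_rank (P : krieger_vertex X) : exists k, has_rank (sval P) k.
Proof.
case: P => P [x /right_rays_doubled_cover[q qx] PE] /=.
by rewrite PE; exact: has_rank_P_inf qx.
Qed.

(** If both copies of v read [a x], then [a] labels a step to both copies of some u with u = v or
    [lt v u], and [x] is read from both. Hence [P'] has rank u. From rank [None] every rank is
    allowed. *)
Lemma krieger_step_rank P P' k k' : krieger_step P P' ->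
  has_rank (sval P) k -> has_rank (sval P') k' -> k = k' \/ rank_lt k k'.
Proof.
case=> a [x [_ PE P'E]]; case: k => [v|]; last by case: k' => [v|]; [right|left].
rewrite /= PE P_inf_doubled_cover => E.
have from_ax s : ray_from (G := G) (Some (v, s)) (ray_cons a x).
  apply/(rays_into_in_ray [set q | ray_from (G := G) q (ray_cons a x)]).
  by rewrite E; apply/rays_into_in_ray; exists s.
have [p [vp aE px]] := iffLR (ray_from_step _ _ _) (from_ax true).
have [q [vq aE' qx]] := iffLR (ray_from_step _ _ _) (from_ax false).
(* If [p] or [q] were [None], its edge would have a label of its own, but [a] labels an edge from
   each of the two copies. *)
case: p q vp vq aE aE' px qx => [[u t]|] [[u' t']|] //=; try by move=> _ _ ->.
move=> /andP[/eqP<- vu] /andP[/eqP<- _] -> [<-] px qx.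
have in_P' s : sval P' (in_ray (Some (u, s))).
  rewrite P'E P_inf_doubled_cover; apply/rays_into_in_ray.
  by case: s.
case: k' => [w|] /= P'k; last first.
  case: P'k => r P'r; move: in_P'; rewrite P'r => in_P'.
  have /rays_into_in_ray /= tr := in_P' true.
  by have /rays_into_in_ray /= := in_P' false; rewrite -tr.
have := in_P' true; rewrite P'k => /rays_into_in_ray[s [uw _]].
by rewrite -uw; case/orP: vu => [/eqP->|]; [left|right].
Qed.

Lemma gpath_rank (P P' : krieger_vertex X) p k k' :
  gpath (G := left_krieger_cover X) P p P' ->
  has_rank (sval P) k -> has_rank (sval P') k' -> k = k' \/ rank_lt k k'.
Proof.
elim: p P k => [P k /= -> Pk P'k'|e p IHp P k /= [eP ePp] Pk P'k'].
  by left; apply: has_rank_inj Pk P'k'.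
have [k1 Qk1] := exists_has_rank (tgt e).
have PQ : krieger_step P (tgt e) by apply/krieger_stepP; exists e.
have k1k' := IHp _ _ ePp Qk1 P'k'.
have [->//|kk1] := krieger_step_rank PQ Pk Qk1.
case: k1k' => [<-|k1k']; first by right.
by right; apply: rank_lt_trans kk1 k1k'.
Qed.

Lemma P_inf_out_ray q : P_inf X (out_ray q) = rays_into [set q].
Proof.
rewrite P_inf_doubled_cover; congr rays_into.
by apply/seteqP; split=> p /ray_from_out.
Qed.

Lemma P_inf_loop_ray v : P_inf X (loop_ray v) = rays_into (doubled v).
Proof.
rewrite P_inf_doubled_cover; congr rays_into.
by apply/seteqP; split=> p /ray_from_loop.
Qed.

(** The letter [(None, q)] occurs on one edge only and so reveals its source. *)
Lemma P_inf_None_step q x : ray_from (G := G) q x ->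
  P_inf X (ray_cons (None, q) x) = rays_into [set None].
Proof.
move=> qx; rewrite P_inf_doubled_cover; congr rays_into.
apply/seteqP; split=> [p /= /ray_from_step[q' [_ E _]]|_ ->].
  by have /(_ (or_introl erefl)) [->] := @step_label_None None q p q' E.
by apply/ray_from_step; exists q.
Qed.

Lemma P_inf_step_None q :
  P_inf X (ray_cons (q, None) (out_ray None)) = rays_into [set q].
Proof.
(* What remains is that [out_ray None] is [star_ray]. *)
rewrite -P_inf_out_ray; congr (P_inf _ (ray_cons _ _)).
by apply/funext => -[].
Qed.

Lemma right_rays_out_ray q : right_rays X (out_ray q).
Proof. by apply/right_rays_doubled_cover; exists q; apply/ray_from_out. Qed.

Lemma right_rays_loop_ray v : right_rays X (loop_ray v).
Proof.
apply/right_rays_doubled_cover; exists (Some (v, true)).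
by apply/ray_from_loop; exists true.
Qed.

Lemma P_inf_doubled_step u v : u = v \/ lt u v ->
  P_inf X (ray_cons (Some (u, true), Some (v, true)) (loop_ray v)) =
  rays_into (doubled u).
Proof.
move=> uv; rewrite P_inf_doubled_cover; congr rays_into.
apply/seteqP; split=> [p /= /ray_from_step[q [_ + _]]|_ [s ->]].
  by case: p q => [[u' s]|] [[v' s']|] //= [-> _]; exists s.
apply/ray_from_step; exists (Some (v, s)); split=> //; last first.
  by apply/ray_from_loop; exists s.
by rewrite /= eqxx; apply/orP; case: uv => [->|->]; [left|right].
Qed.

(** A vertex of rank v reaches one of equal or later rank v' by one edge, which for v = v' is a loop
    or a parallel representative of it. From rank [None] two edges suffice, through the vertex [N]
    of the state [None]. *)
Lemma rank_gpath (P P' : krieger_vertex X) k k' :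
  has_rank (sval P) k -> has_rank (sval P') k' -> k = k' \/ rank_lt k k' ->
  exists2 p, gpath (G := left_krieger_cover X) P p P' & (0 < size p)%N.
Proof.
have path1 Q Q' : krieger_step Q Q' ->
    exists2 p, gpath (G := left_krieger_cover X) Q p Q' & (0 < size p)%N.
  by move=> /krieger_stepP[e [eQ eQ']]; exists [:: e].
have path2 Q Q' Q'' : krieger_step Q Q' -> krieger_step Q' Q'' ->
    exists2 p, gpath (G := left_krieger_cover X) Q p Q'' & (0 < size p)%N.
  move=> /krieger_stepP[e [eQ eQ']] /krieger_stepP[f [fQ' fQ'']].
  by exists [:: e; f] => //; split=> //; split=> //; exact: etrans fQ' (esym eQ').
have [N NE] := krieger_vertex_P_inf (right_rays_out_ray None).
rewrite P_inf_out_ray in NE.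
have toN Q q : sval Q = rays_into [set q] -> krieger_step Q N.
  move=> QE; exists (q, None), (out_ray None).
  by rewrite QE NE P_inf_step_None P_inf_out_ray; split=> //; exact: right_rays_out_ray.
case: k k' => [u|] [v|] /=.
- move=> PE P'E uv; apply: path1.
  exists (Some (u, true), Some (v, true)), (loop_ray v).
  rewrite PE P'E P_inf_loop_ray P_inf_doubled_step; last by case: uv => [[]|]; auto.
  by split=> //; exact: right_rays_loop_ray.
- by move=> _ _ [].
- move=> [q PE] P'E _; apply: (path2 _ N); first exact: toN PE.
  exists (None, Some (v, true)), (loop_ray v).
  rewrite NE P'E P_inf_loop_ray P_inf_None_step; last first.
    by apply/ray_from_loop; exists true.
  by split=> //; exact: right_rays_loop_ray.
- move=> [q PE] [q' P'E] _; apply: (path2 _ N); first exact: toN PE.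
  exists (None, q'), (out_ray q').
  rewrite NE P'E P_inf_out_ray P_inf_None_step; last exact/ray_from_out.
  by split=> //; exact: right_rays_out_ray.
Qed.

Lemma krieger_rank : exists rank : krieger_vertex X -> option W,
  (forall k, exists P, rank P = k) /\
  (forall P P', (exists2 p, gpath (G := left_krieger_cover X) P p P' &
       (0 < size p)%N) <->
     rank P = rank P' \/ rank_lt (rank P) (rank P')).
Proof.
have [rank rankP] := choice exists_has_rank; exists rank; split=> [k|P P'].
  suff [P Pk] : exists P : krieger_vertex X, has_rank (sval P) k.
    by exists P; apply: has_rank_inj (rankP P) Pk.
  case: k => [v|].
    have [P PE] := krieger_vertex_P_inf (right_rays_loop_ray v).
    by exists P; rewrite PE P_inf_loop_ray.
  have [P PE] := krieger_vertex_P_inf (right_rays_out_ray None).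
  by exists P, None; rewrite PE P_inf_out_ray.
split=> [[p PpP' _]|]; first exact: gpath_rank PpP' (rankP P) (rankP P').
exact: rank_gpath.
Qed.

End DoubledCover.

(** * From the given graph to the doubled one *)

Lemma gt_irreflexive (V : finType) (e : rel V) :
  (forall x p, ~~ circuit e x p) -> irreflexive e.
Proof.
by move=> nc x; have := nc x [:: x]; rewrite /circuit /= eqxx !andbT => /negPf.
Qed.

(** The endpoints of two consecutive edges differ, as otherwise these edges would form a circuit of
    length 2. *)
Lemma gt_transitive (V : finType) (e : rel V) :
  (forall x p, ~~ circuit e x p) ->
  (forall u v, vertex_gt e u v -> e u v) -> transitive e.
Proof.
move=> nc gt y x z xy yz; apply: gt; apply/andP; split.
  exact: connect_trans (connect1 xy) (connect1 yz).
by apply/eqP => xz; have := nc x [:: y; z]; rewrite /circuit /= xy yz xz eqxx.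
Qed.

Theorem proposition3p26 (V : finType) (e : rel V)
  (has_root : exists! r : V, maximal_vertex e r)
  (no_circuit : forall (x : V) (p : seq V), ~~ circuit e x p)
  (edge_of_gt : forall u v : V, vertex_gt e u v -> e u v) :
  exists (A : finType) (X : set (int -> A)),
    AFT_shift X /\ isomorphic_to_PC e (left_krieger_cover X).
Proof.
have irr := gt_irreflexive no_circuit.
have tr := gt_transitive no_circuit edge_of_gt.
have [r [root_r _]] := has_root.
have er v : v != r -> e r v.
  by move=> vr; apply: edge_of_gt; rewrite /vertex_gt root_r // eq_sym.
have nre v : ~~ e v r.
  apply/negP => vr; have := irr r; have [vE|/er rv] := eqVneq v r.
    by rewrite -{1}vE vr.
  by rewrite (tr _ _ _ rv vr).
pose W : finType := {v : V | v != r}.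
pose lt : rel W := fun u v => e (val u) (val v).
have lt_tr : transitive lt by move=> v u w; exact: tr.
exists _, (label_shift (doubled_cover lt)); split; first exact: AFT_doubled_cover.
have [rank [rank_surj rankP]] := krieger_rank lt_tr.
(* The default value puts the root back in the place of [None]. *)
pose h (k : option W) : V := oapp val r k.
have h_inj : injective h.
  case=> [[u ur]|] [[v vr]|] //= E.
  - by congr Some; apply: val_inj.
  - by case/eqP: ur.
  - by case/eqP: vr; rewrite -E.
have eh k k' : e (h k) (h k') = rank_lt lt k k'.
  case: k k' => [u|] [v|] //=; [exact/negbTE|exact: er (valP v)].
apply: (@isomorphic_to_PC_of_rank _ _ (left_krieger_cover _) (h \o rank)) => // [v|P P'].
  have [vr|vr] := eqVneq v r.
    by have [P Pk] := rank_surj None; exists P; rewrite /= Pk vr.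
  by have [P Pk] := rank_surj (Some (Sub v vr)); exists P; rewrite /= Pk.
rewrite rankP /= eh; split=> [[->|]|[/h_inj|]]; by [left|right].
Qed.
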